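(* Let $\Gamma$ be a semigroup acting minimally by continuous maps on a compact metric space $X$. Let $\mathcal{H}$ be either a proper CAT(0) space or a real separable Hilbert space. For each $f\in\Gamma$ let $I(f,\cdot):X\to \mathrm{Isom}(\mathcal{H})$ be a continuous map, and assume the cocycle relation $I(fg,x)=I(f,g(x))\,I(g,x)$ holds for all $f,g\in\Gamma$ and $x\in X$, so that $f:(x,v)\mapsto (f(x),I(f,x)v)$ defines a skew action of $\Gamma$ on $X\times\mathcal{H}$. Assume that for some $x_0\in X$ and $v_0\in\mathcal{H}$ there is a bounded subset $B\subset\mathcal{H}$ such that $I(f,x_0)v_0\in B$ for every $f\in\Gamma$. Then there exists a continuous map $\varphi:X\to\mathcal{H}$ whose graph $x\mapsto (x,\varphi(x))$ is invariant under the skew action, that is, $$I(f,x)\varphi(x)=\varphi(f(x))\qquad\text{for all } f\in\Gamma \text{ and all } x\in X.$$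
   Context: The action of $\Gamma$ on $X$ is minimal if for every $x\in X$ the orbit $\{f(x): f\in\Gamma\}$ is dense in $X$. $\mathrm{Isom}(\mathcal{H})$ is the group of (surjective) isometries of $\mathcal{H}$. If $\mathcal{H}$ is a proper CAT(0) space (closed balls compact), $\mathrm{Isom}(\mathcal{H})$ carries the usual (compact-open, equivalently pointwise convergence) topology. If $\mathcal{H}$ is a Hilbert space, write $I(f,x)v=\Psi(f,x)v+\rho(f,x)$ with $\Psi(f,x)$ a linear isometry and $\rho(f,x)\in\mathcal{H}$; continuity of $I(f,\cdot)$ means that $\Psi(f,\cdot)$ is continuous for the operator norm and $\rho(f,\cdot)$ is continuous for the norm topology of $\mathcal{H}$. Continuity of $\varphi$ is with respect to the metric (norm) topology of $\mathcal{H}$. *)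

(* Defs.v *)
From HB Require Import structures.
From mathcomp Require Import all_boot all_order all_algebra.
From mathcomp Require Import all_classical all_reals all_analysis.

Set Implicit Arguments.
Unset Strict Implicit.
Unset Printing Implicit Defensive.

Import Order.TTheory GRing.Theory Num.Theory.
Import numFieldNormedType.Exports.

Local Open Scope classical_set_scope.
Local Open Scope ring_scope.

(* The distance [d] is a parameter because [metricType] and [normedModType]
   are unrelated structures: [d] is [mdist] in the former case and the
   distance of the norm in the latter. *)
Record isom (R : realType) (T : Type) (d : T -> T -> R) := Isom {
  isom_fun :> T -> T;
  isom_dist : forall u v, d (isom_fun u) (isom_fun v) = d u v;
  isom_surj : forall w, exists v, isom_fun v = w
}.

Section Action.
Variables (Gamma : semigroupType) (X : topologicalType).
Implicit Type act : Gamma -> X -> X.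

Definition continuous_semigroup_action act :=
  (forall f g x, act (f * g)%g x = act f (act g x)) /\
  (forall f, continuous (act f)).

Definition minimal_action act :=
  forall x, dense [set act f x | f in [set: Gamma]].

Definition isom_cocycle (R : realType) (H : Type) (d : H -> H -> R) act
    (I : Gamma -> X -> isom d) :=
  forall f g x, I (f * g)%g x = I f (act g x) \o I g x :> (H -> H).

End Action.

Section MetricSpace.
Variables (R : realType) (M : metricType R).

(* Not the library's [closed_ball], which is the closure of the open ball. *)
Definition proper_space :=
  forall (x : M) (r : R), compact [set y | mdist x y <= r].

Definition metric_bounded (B : set M) :=
  exists r : R, forall u v, B u -> B v -> mdist u v <= r.

(* Only the values of [c] on [0, mdist p q] matter. *)
Definition geodesic (p q : M) (c : R -> M) :=
  [/\ c 0 = p, c (mdist p q) = q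
    & {in `[0, mdist p q] &, forall s t, mdist (c s) (c t) = `|s - t|}].

Definition geodesic_space := forall p q : M, exists c, geodesic p q c.

(* The library norm on ['rV_2] is the sup norm, hence this definition. *)
Definition edist (a b : 'rV[R]_2) : R :=
  Num.sqrt (\sum_(k < 2) (a ord0 k - b ord0 k) ^+ 2).

Definition esegment (a b : 'rV[R]_2) : set 'rV[R]_2 :=
  [set (1 - t) *: a + t *: b | t in `[0, 1]].

(* The sides of the triangle are indexed cyclically: [c i] joins [p i] to
   [p (ordS i)].  The point of the Euclidean side [a i, a (ordS i)]
   at distance [s] from [a i] is the comparison point of [c i s]. *)
Definition cat0_space :=
  geodesic_space /\
  forall (p : 'I_3 -> M) (c : 'I_3 -> R -> M) (a : 'I_3 -> 'rV[R]_2),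
    (forall i, geodesic (p i) (p (ordS i)) (c i)) ->
    (forall i j, edist (a i) (a j) = mdist (p i) (p j)) ->
    forall (i j : 'I_3) (s t : R) (x y : 'rV[R]_2),
      s \in `[0, mdist (p i) (p (ordS i))] ->
      t \in `[0, mdist (p j) (p (ordS j))] ->
      esegment (a i) (a (ordS i)) x -> edist (a i) x = s ->
      esegment (a j) (a (ordS j)) y -> edist (a j) y = t ->
      mdist (c i s) (c j t) <= edist x y.

End MetricSpace.

(* On [isom], which is a subspace of [H -> H]. *)
Definition compact_open_continuous (R : realType) (X : topologicalType)
    (H : metricType R) (J : X -> isom (@mdist R H)) :=
  continuous (fun x => J x : {compact-open, H -> H}).

Definition norm_dist (R : realType) (H : normedModType R) (u v : H) : R :=
  `|u - v|.

Section HilbertSpace.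
Variables (R : realType) (H : completeNormedModType R).

Definition hilbert_space :=
  exists dot : {dot H for idfun}, forall v : H, dot v v = `|v| ^+ 2.

Definition separable_space := exists2 D : set H, countable D & dense D.

Definition translation_part (J : isom (@norm_dist R H)) : H := J 0.

(* Linear, by the Mazur-Ulam theorem. *)
Definition linear_part (J : isom (@norm_dist R H)) (v : H) : H :=
  J v - translation_part J.

(* Meaningful only if [T] is bounded on the unit ball; below it is applied to
   differences of two linear isometries, bounded by 2 there. *)
Definition operator_norm (T : H -> H) : R :=
  sup [set `|T v| | v in [set v | `|v| <= 1]].

Definition operator_norm_continuous (X : topologicalType)
    (J : X -> isom (@norm_dist R H)) :=
  (forall x, operator_norm (fun v => linear_part (J y) v - linear_part (J x) v)
               @[y --> x] --> (0 : R)) /\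
  continuous (fun x => translation_part (J x)).

End HilbertSpace.

Arguments proper_space {R} M.
Arguments cat0_space {R} M.
Arguments hilbert_space {R} H.
Arguments separable_space {R} H.

(* Main.v *)
Require Import Defs.
From mathcomp Require Import all_boot all_order all_algebra.
From mathcomp Require Import all_classical all_reals all_analysis.
From mathcomp Require Import ring lra.
Import Order.TTheory GRing.Theory Num.Theory.
Import numFieldNormedType.Exports.
Local Open Scope classical_set_scope.
Local Open Scope ring_scope.

(* Let O y be the set of heights over y of the bounded orbit of (x0, v0). An
   asymptotic centre of O at x is a point c minimizing the upper limit, as y
   tends to x, of the radius of the smallest ball centred at c containing O y;
   call the minimum r(x). Then r is upper semicontinuous by construction, and
   r(x) <= r(f x) because O is invariant and I(f, .) is pointwise continuous, so
   minimality makes r constant. The Bruhat-Tits inequality and completeness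
   yield existence and uniqueness of the centre phi(x). The constancy of r
   makes phi equivariant, and also continuous: a nearly optimal bound at x
   persists near x, and nearly optimal bounds have close centres. Everything
   takes place in the metric topology, so no weak compactness is needed in the
   Hilbert case. *)

(** * Asymptotic centres under completeness and the Bruhat-Tits inequality *)

Definition sequentially_complete (R : realType) (T : Type) (d : T -> T -> R) :=
  forall u : nat -> T,
    (forall e, 0 < e -> exists N, forall m n,
       (N <= m)%N -> (N <= n)%N -> d (u m) (u n) < e) ->
    exists l, forall e, 0 < e -> exists N, forall n, (N <= n)%N -> d (u n) l < e.

Definition bruhat_tits_inequality (R : realType) (T : Type) (d : T -> T -> R) :=
  forall p q, exists m, forall z,
    d z m ^+ 2 <= (d z p ^+ 2 + d z q ^+ 2) / 2 - d p q ^+ 2 / 4.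

Section AsymptoticCenter.
Variables (R : realType) (T : Type) (d : T -> T -> R).
Hypothesis d_ge0 : forall u v, 0 <= d u v.
Hypothesis d_sym : forall u v, d u v = d v u.
Hypothesis d_triangle : forall w u v, d u v <= d u w + d w v.
Hypothesis d_sep : forall u v, d u v = 0 -> u = v.
Hypothesis d_complete : sequentially_complete R T d.
Hypothesis d_cn : bruhat_tits_inequality R T d.

Variables (X : topologicalType) (O : X -> set T).
Hypothesis O_dense : forall (x : X) (U : set X), nbhs x U -> exists y v, U y /\ O y v.
Hypothesis O_bounded : exists c a, forall y v, O y v -> d v c <= a.

(** Fibres [O y] may be empty; [O_dense] keeps the bound from being vacuous. *)
Definition asymptotic_bound (x : X) (c : T) (a : R) :=
  \forall y \near x, forall v, O y v -> d v c <= a.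

Definition asymptotic_radius (x : X) : R :=
  inf [set a | exists c, asymptotic_bound x c a].

Lemma asymptotic_bound_ge0 x c a : asymptotic_bound x c a -> 0 <= a.
Proof.
by move=> /O_dense[y [v [le_a Oyv]]]; apply: le_trans (le_a v Oyv).
Qed.

Lemma has_inf_asymptotic_bound x :
  has_inf [set a | exists c, asymptotic_bound x c a].
Proof.
split; last by exists 0 => a [c /asymptotic_bound_ge0].
have [c [a le_a]] := O_bounded.
by exists a, c; apply: filterE => y v; apply: le_a.
Qed.

Lemma asymptotic_radius_le x c a :
  asymptotic_bound x c a -> asymptotic_radius x <= a.
Proof.
move=> xca; apply: ge_inf; last by exists c.
by have [] := has_inf_asymptotic_bound x.
Qed.

Lemma asymptotic_radius_ge0 x : 0 <= asymptotic_radius x.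
Proof.
apply: lb_le_inf; first by have [] := has_inf_asymptotic_bound x.
by move=> a [c /asymptotic_bound_ge0].
Qed.

(** A bound at [x] lives on a neighbourhood of [x]; this is what makes the radius upper
    semicontinuous. *)
Lemma asymptotic_bound_near {x c a} :
  asymptotic_bound x c a -> \forall y \near x, asymptotic_bound y c a.
Proof. exact: nbhs_interior. Qed.

Lemma asymptotic_bound_exists x e : 0 < e ->
  exists c, asymptotic_bound x c (asymptotic_radius x + e).
Proof.
move=> e0; have [a [c xca] lt_a] := inf_adherent e0 (has_inf_asymptotic_bound x).
exists c; apply: filterS xca => y le_a v Oyv.
exact: le_trans (le_a v Oyv) (ltW lt_a).
Qed.

(** By the Bruhat-Tits inequality the midpoint [m] of [c1] and [c2] has an asymptotic bound whose
    square is [s], and no bound is smaller than the radius. *)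
Lemma asymptotic_bound_dist x c1 c2 a1 a2 :
  asymptotic_bound x c1 a1 -> asymptotic_bound x c2 a2 ->
  d c1 c2 ^+ 2 <= 2 * (a1 ^+ 2 + a2 ^+ 2) - 4 * asymptotic_radius x ^+ 2.
Proof.
move=> x1 x2; have [m cn_m] := d_cn c1 c2.
pose s := (a1 ^+ 2 + a2 ^+ 2) / 2 - d c1 c2 ^+ 2 / 4.
have xms : \forall y \near x, forall v, O y v -> d v m ^+ 2 <= s.
  apply: filterS2 x1 x2 => y y1 y2 v Oyv; apply: le_trans (cn_m v) _.
  rewrite lerD2r ler_pM2r ?invr_gt0 ?ltr0n// lerD// ler_sqr ?nnegrE//.
  - exact: y1.
  - by apply: le_trans (y1 v Oyv).
  - exact: y2.
  - by apply: le_trans (y2 v Oyv).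
(* A nonempty fibre near [x] forces this sign, so that [Num.sqrt s] is a bound with square [s]. *)
have s_ge0 : 0 <= s.
  have [y [v [le_s Oyv]]] := O_dense _ _ xms.
  exact: le_trans (sqr_ge0 _) (le_s v Oyv).
have : asymptotic_radius x ^+ 2 <= s.
  rewrite -[s]sqr_sqrtr// ler_sqr ?nnegrE ?sqrtr_ge0 ?asymptotic_radius_ge0//.
  apply: (@asymptotic_radius_le _ m); apply: filterS xms => y le_s v Oyv.
  by rewrite -[d v m]ger0_norm// -sqrtr_sqr ler_sqrt// le_s.
rewrite /s; lra.
Qed.

(** The threshold [t] depends on [r] and [e] but not on [x]; continuity of the centre needs this
    uniformity. *)
Lemma asymptotic_bound_close r e : 0 <= r -> 0 < e -> exists2 t, 0 < t &
  forall x c1 c2, asymptotic_radius x = r ->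
    asymptotic_bound x c1 (r + t) -> asymptotic_bound x c2 (r + t) ->
    d c1 c2 < e.
Proof.
move=> r0 e0.
(* Two bounds [r + t] give a squared distance of at most [8 r t + 4 t ^ 2], which for [t <= 1] is
   below [16 t (r + 1)]. *)
pose t := Num.min 1 (e ^+ 2 / (16 * (r + 1))).
have t_gt0 : 0 < t by rewrite lt_min ltr01/= divr_gt0// ?exprn_gt0//; lra.
have t_le1 : t <= 1 by rewrite ge_min lexx.
have t_le : t * (16 * (r + 1)) <= e ^+ 2.
  by rewrite -ler_pdivlMr ?ge_min ?lexx ?orbT//; lra.
exists t => // x c1 c2 xr x1 x2; have := asymptotic_bound_dist _ _ _ _ _ x1 x2.
rewrite xr => le_d; rewrite -ltr_sqr ?nnegrE// ?ltW//.
apply: le_lt_trans le_d _; nra.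
Qed.

(** The slack [e] is there because the neighbourhood may shrink with [e]: the radius itself need not
    be a bound on any neighbourhood. *)
Definition asymptotic_center (x : X) (c : T) :=
  forall e, 0 < e -> asymptotic_bound x c (asymptotic_radius x + e).

Lemma asymptotic_bound_weaken {x c a b} : a <= b ->
  asymptotic_bound x c a -> asymptotic_bound x c b.
Proof. by move=> ab; apply: filterS => y le_a v /le_a/le_trans; apply. Qed.

(** Nearly optimal centres with slack tending to 0 form a Cauchy sequence, and its limit is a
    centre. *)
Lemma asymptotic_center_exists x : exists c, asymptotic_center x c.
Proof.
have /choice[u xu] : forall n, exists c,
    asymptotic_bound x c (asymptotic_radius x + n.+1%:R^-1).
  by move=> n; apply: asymptotic_bound_exists; rewrite invr_gt0.
have u_bound e : 0 < e -> exists N, forall n, (N <= n)%N ->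
    asymptotic_bound x (u n) (asymptotic_radius x + e).
  move=> e0; exists (Num.truncn e^-1) => n le_n.
  apply: asymptotic_bound_weaken (xu n); rewrite lerD2l.
  rewrite -[e]invrK lef_pV2 ?posrE ?invr_gt0//.
  by apply: ltW; rewrite -truncn_lt_nat ?invr_ge0 ?ltW.
have /d_complete[c u_c] : forall e, 0 < e -> exists N, forall m n,
    (N <= m)%N -> (N <= n)%N -> d (u m) (u n) < e.
  move=> e /(asymptotic_bound_close _ _ (asymptotic_radius_ge0 x))[t t0 close_t].
  have [N uN] := u_bound t t0.
  by exists N => m n Nm Nn; apply: (close_t x) => //; apply: uN.
exists c => e e0; have e20 : 0 < e / 2 by rewrite divr_gt0.
have [[N uN] [M uM]] := (u_c _ e20, u_bound _ e20).
have := uM (maxn N M) (leq_maxr N M); apply: filterS => y le_y v Oyv.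
apply: le_trans (d_triangle (u (maxn N M)) v c) _.
by rewrite [e]splitr addrA lerD ?le_y// ltW// uN// leq_maxl.
Qed.

Lemma asymptotic_center_unique {x c1 c2} :
  asymptotic_center x c1 -> asymptotic_center x c2 -> c1 = c2.
Proof.
move=> x1 x2; apply: d_sep; apply/eqP; rewrite eq_le d_ge0 andbT.
apply/ler_addgt0Pl => e e0; rewrite addr0 ltW//.
have [t t0 close_t] :=
    asymptotic_bound_close _ _ (asymptotic_radius_ge0 x) e0.
by apply: (close_t x) => //; [apply: x1 | apply: x2].
Qed.

(** * Equivariance and continuity of the asymptotic centre *)

Variables (Gamma : Type) (act : Gamma -> X -> X) (I : Gamma -> X -> isom d).
Hypothesis act_continuous : forall f, continuous (act f).
Hypothesis act_minimal : forall (x y : X) (U : set X), nbhs y U -> exists f, U (act f x).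
Hypothesis I_continuous : forall f v x e, 0 < e ->
  \forall y \near x, d (I f y v) (I f x v) < e.
Hypothesis O_invariant : forall f y v, O y v -> O (act f y) (I f y v).

(** For [y] near [x], the isometry [I f y] sends [O y] into [O (act f y)] and moves [c] to within
    [e] of [I f x c]. *)
Lemma asymptotic_bound_pullback f x c a e : 0 < e ->
  asymptotic_bound (act f x) (I f x c) a -> asymptotic_bound x c (a + e).
Proof.
move=> e0 /(act_continuous f x) fx_a.
have x_e := I_continuous f c x e e0; near=> y => v Oyv.
have le_a : forall v, O (act f y) v -> d v (I f x c) <= a by near: y.
have lt_e : d (I f y c) (I f x c) < e by near: y.
rewrite -(isom_dist (I f y)); apply: le_trans (d_triangle (I f x c) _ _) _.
apply: lerD; first exact/le_a/O_invariant.
by rewrite d_sym ltW.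
Unshelve. all: by end_near.
Qed.

Lemma asymptotic_radius_act f x :
  asymptotic_radius x <= asymptotic_radius (act f x).
Proof.
apply/ler_addgt0Pr => e e0; have e20 : 0 < e / 2 by rewrite divr_gt0.
have [c xc] := asymptotic_bound_exists (act f x) _ e20.
have [w wc] := isom_surj (I f x) c.
apply: (@asymptotic_radius_le _ w).
rewrite [e]splitr addrA; apply: (asymptotic_bound_pullback f) => //.
by rewrite wc.
Qed.

(** A nearly optimal bound at [y] persists nearby, and by minimality some [act f x] lies there; the
    radius at [x] is at most that at [act f x]. *)
Lemma asymptotic_radius_constant x y :
  asymptotic_radius x = asymptotic_radius y.
Proof.
wlog suff le_xy : x y / asymptotic_radius x <= asymptotic_radius y.
  by apply/eqP; rewrite eq_le !le_xy.
apply/ler_addgt0Pr => e e0.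
have [c yc] := asymptotic_bound_exists y e e0.
have [f fx_c] := act_minimal x y _ (asymptotic_bound_near yc).
exact: le_trans (asymptotic_radius_act f x) (asymptotic_radius_le _ _ _ fx_c).
Qed.

Lemma asymptotic_center_graph : exists phi : X -> T,
  (forall x e, 0 < e -> \forall y \near x, d (phi x) (phi y) < e) /\
  (forall f x, I f x (phi x) = phi (act f x)).
Proof.
have [phi phiP] := choice asymptotic_center_exists.
exists phi; split=> [x e e0|f x].
  have [t t0 close_t] :=
    asymptotic_bound_close _ _ (asymptotic_radius_ge0 x) e0.
  (* Near [x], the point [phi x] is nearly optimal at [y] too, since the radius at [y] is the
     same. *)
  apply: filterS (asymptotic_bound_near (phiP x t t0)) => y yx.
  apply: (close_t y) => //; first exact: asymptotic_radius_constant.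
  by rewrite (asymptotic_radius_constant x y); apply: phiP.
(* The preimage [w] of [phi (act f x)] under [I f x] is a centre at [x], hence equals [phi x]. *)
have [w wc] := isom_surj (I f x) (phi (act f x)).
rewrite -wc; congr (I f x _); apply: (asymptotic_center_unique (phiP x)) => e e0.
have e20 : 0 < e / 2 by rewrite divr_gt0.
rewrite [e]splitr addrA; apply: (asymptotic_bound_pullback f) => //.
by rewrite wc (asymptotic_radius_constant x (act f x)); apply: phiP.
Qed.

End AsymptoticCenter.

(** * From a bounded orbit to an invariant graph *)

Theorem bounded_orbit_invariant_graph (R : realType) (T : Type) (d : T -> T -> R)
    (X : topologicalType) (Gamma : semigroupType) (act : Gamma -> X -> X)
    (I : Gamma -> X -> isom d) :
  (forall u v, 0 <= d u v) -> (forall u v, d u v = d v u) ->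
  (forall w u v, d u v <= d u w + d w v) -> (forall u v, d u v = 0 -> u = v) ->
  sequentially_complete R T d -> bruhat_tits_inequality R T d ->
  continuous_semigroup_action act -> minimal_action act ->
  isom_cocycle act I ->
  (forall f v x e, 0 < e -> \forall y \near x, d (I f y v) (I f x v) < e) ->
  (exists (x0 : X) (v0 : T) (B : set T),
     (exists r : R, forall u v, B u -> B v -> d u v <= r) /\
     forall f, B (I f x0 v0)) ->
  exists phi : X -> T,
    (forall x e, 0 < e -> \forall y \near x, d (phi x) (phi y) < e) /\
    (forall f x, I f x (phi x) = phi (act f x)).
Proof.
move=> d_ge0 d_sym d_triangle d_sep d_complete d_cn [actM act_cont] act_min.
move=> I_cocycle I_cont [x0 [v0 [B [[r Br] BI]]]].
have act_orbit (x y : X) (U : set X) : nbhs y U -> exists f, U (act f x).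
  rewrite nbhsE => -[V [oV Vy] VU].
  have [z [/VU Uf [f _ ff]]] := act_min x V (ex_intro _ y Vy) oV.
  by exists f; rewrite ff.
pose O y v := exists f, y = act f x0 /\ v = I f x0 v0.
(* Minimality makes [Gamma] nonempty; the orbit point of [f0] then serves as centre of a ball
   containing the bounded orbit. *)
have [f0 _] := act_orbit x0 x0 _ filterT.
apply: (@asymptotic_center_graph _ _ _ _ _ _ _ _ _ _ O) => //.
- move=> x U /(act_orbit x0)[f Uf].
  by exists (act f x0), (I f x0 v0); split=> //; exists f.
- by exists (I f0 x0 v0), r => _ _ [f [_ ->]]; apply: Br.
- move=> f _ _ [g [-> ->]]; exists (f * g)%g.
  by rewrite actM I_cocycle.
Qed.

(** * Proper CAT(0) spaces *)

Section ProperCat0.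
Variables (R : realType) (M : metricType R).

(** A tail of the sequence lies in a compact ball of radius 1, and a Cauchy sequence converges to
    any of its cluster points. *)
Lemma proper_sequentially_complete :
  proper_space M -> sequentially_complete R M (@mdist R M).
Proof.
move=> properM u u_cauchy; have [N uN] := u_cauchy 1 ltr01.
have u_ball : (u @ \oo) [set y | mdist (u N) y <= 1].
  by exists N => // n Nn; apply/ltW/uN.
have [l [_ clus_l]] := properM _ _ _ (fmap_proper_filter u _) u_ball.
exists l => e e0; have e20 : 0 < e / 2 by rewrite divr_gt0.
have [K uK] := u_cauchy _ e20; exists K => n Kn.
have /clus_l/(_ (nbhsx_ballx l _ e20)) : (u @ \oo) [set y | mdist (u n) y < e / 2].
  by exists K => // m Km; apply: uK.
move=> [y [ny]]; rewrite ballEmdist/= => ly.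
apply: le_lt_trans (metric_triangle (u n) y l) _.
by rewrite [e]splitr ltrD// metric_sym.
Qed.

Lemma compact_open_continuous_pointwise (X : topologicalType)
    (J : X -> isom (@mdist R M)) :
  compact_open_continuous J -> forall v, continuous (fun x => J x v : M).
Proof.
move=> Jcont v x W; rewrite nbhsE/= => -[V [oV Vx] VW].
have /compact_open_cvgP Jx := Jcont x.
have := Jx [set v] V (@compact_set1 _ v) oV.
rewrite image_set1 => JxV.
have {}JxV : \forall y \near x, J y @` [set v] `<=` V by apply: JxV => _ ->.
change (\forall y \near x, W (J y v)).
by apply: filterS JxV => y yV; apply/VW/yV; exists v.
Qed.

(** A Euclidean triangle with sides [D], [b], [e]: the base runs from [(0, 0)] to [(D, 0)] and the
    apex is [(x, y)]. *)
Lemma comparison_triangle (D b e : R) : 0 <= D -> 0 <= b -> 0 <= e ->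
  D <= b + e -> b <= D + e -> e <= D + b ->
  exists x y, x ^+ 2 + y ^+ 2 = b ^+ 2 /\ (D - x) ^+ 2 + y ^+ 2 = e ^+ 2.
Proof.
rewrite le_eqVlt => /predU1P[<- b0 e0 _|D0 b0 e0 Dbe bDe eDb].
  rewrite !add0r => be eb; exists b, 0.
  have -> : e = b by apply/eqP; rewrite eq_le be eb.
  by split; ring.
(* The abscissa of the apex, by the law of cosines. *)
pose x := (D ^+ 2 + b ^+ 2 - e ^+ 2) / (2 * D).
have xD : x * (2 * D) = D ^+ 2 + b ^+ 2 - e ^+ 2.
  by rewrite divfK// gt_eqF// mulr_gt0.
have xb : x ^+ 2 <= b ^+ 2.
  have D2_gt0 : 0 < (2 * D) ^+ 2 by rewrite exprn_gt0// mulr_gt0.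
  rewrite -subr_ge0 -(pmulr_lge0 _ D2_gt0).
  (* Heron's factorization; each factor is nonnegative by a triangle inequality or a sign
     hypothesis. *)
  have -> : (b ^+ 2 - x ^+ 2) * (2 * D) ^+ 2 =
      (e - (D - b)) * (e + (D - b)) * ((D + b - e) * (D + b + e)).
    by rewrite mulrBl -!exprMn xD; ring.
  by rewrite !mulr_ge0//; lra.
exists x, (Num.sqrt (b ^+ 2 - x ^+ 2)).
rewrite sqr_sqrtr ?subr_ge0//; split; first by ring.
lra.
Qed.

Definition plane_point (x y : R) : 'rV[R]_2 := \row_j [:: x; y]`_j.

Lemma edist_plane_point x y x' y' :
  Defs.edist (plane_point x y) (plane_point x' y')
  = Num.sqrt ((x - x') ^+ 2 + (y - y') ^+ 2).
Proof. by rewrite /Defs.edist !big_ord_recl big_ord0 !mxE/= addr0. Qed.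

(** The distance from [z] to the midpoint of a geodesic from [p] to [q] is at most the Euclidean
    median, whose length is given by Apollonius' theorem. *)
Lemma cat0_bruhat_tits : cat0_space M -> bruhat_tits_inequality R M (@mdist R M).
Proof.
move=> [geoM catM] p q; have [c pqc] := geoM p q.
exists (c (mdist p q / 2)) => z.
have [x [y [xy_b xy_e]]] : exists x y, x ^+ 2 + y ^+ 2 = mdist p z ^+ 2 /\
    (mdist p q - x) ^+ 2 + y ^+ 2 = mdist q z ^+ 2.
  apply: comparison_triangle; rewrite ?mdist_ge0//.
  - by rewrite [mdist q z]metric_sym metric_triangle.
  - by rewrite metric_triangle.
  - by rewrite [mdist p q]metric_sym metric_triangle.
have [c1 qzc] := geoM q z; have [c2 zpc] := geoM z p.
pose P (i : 'I_3) := nth p [:: p; q; z] i.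
pose C (i : 'I_3) := nth c [:: c; c1; c2] i.
pose A (i : 'I_3) :=
  nth 0 [:: plane_point 0 0; plane_point (mdist p q) 0; plane_point x y] i.
have geoC i : geodesic (P i) (P (ordS i)) (C i).
  by case: i => [[|[|[|]]]].
have sqrt_d (u v : M) r : r = mdist u v ^+ 2 -> Num.sqrt r = mdist u v.
  by move=> ->; rewrite sqrtr_sqr ger0_norm// mdist_ge0.
have distA i j : Defs.edist (A i) (A j) = mdist (P i) (P j).
  case: i => [[|[|[|]]]]//= ?; case: j => [[|[|[|]]]]//= ?;
  rewrite /A /P/= edist_plane_point; apply: sqrt_d;
  rewrite ?mdistxx ?[mdist z _]metric_sym ?[mdist q p]metric_sym -?xy_b -?xy_e;
  ring.
pose i0 := @Ordinal 3 0 isT; pose i2 := @Ordinal 3 2 isT.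
have [zpc0 _ _] := zpc.
have D0 := mdist_ge0 p q.
(* Side 0 carries the midpoint of [p] and [q]; side 2 starts at [z], hence the parameter 0. *)
have := catM P C A geoC distA i0 i2 (mdist p q / 2) 0
  (plane_point (mdist p q / 2) 0) (plane_point x y).
rewrite /C /P /A/= zpc0 !edist_plane_point => le_zm.
have : mdist z (c (mdist p q / 2)) <= Num.sqrt ((mdist p q / 2 - x) ^+ 2 + (0 - y) ^+ 2).
  rewrite [mdist z _]metric_sym; apply: le_zm.
  - by rewrite in_itv/=; apply/andP; split; lra.
  - by rewrite in_itv/= lexx mdist_ge0.
  - exists 2^-1; first by rewrite /= in_itv/=; apply/andP; split; lra.
    by apply/rowP => -[[|[|]]]//= ?; rewrite !mxE/=; lra.
  - by rewrite subr0 expr0n addr0 sub0r sqrrN sqrtr_sqr ger0_norm//; lra.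
  - exists 0; first by rewrite /= in_itv/= lexx ler01.
    by rewrite subr0 scale1r scale0r addr0.
  - by rewrite !subrr expr0n addr0 sqrtr0.
rewrite -ler_sqr ?nnegrE ?mdist_ge0 ?sqrtr_ge0// sqr_sqrtr ?addr_ge0 ?sqr_ge0//.
rewrite [mdist z p]metric_sym [mdist z q]metric_sym -xy_b -xy_e; lra.
Qed.
End ProperCat0.

(** * Hilbert spaces *)

Section HilbertSpace.
Variables (R : realType) (H : completeNormedModType R).

Lemma norm_sequentially_complete : sequentially_complete R H (@norm_dist R H).
Proof.
move=> u u_cauchy.
have /cauchy_cvgP u_cvg : cauchy (u @ \oo).
  apply: cauchy_exP => e e0; have [N uN] := u_cauchy e e0.
  exists (u N); exists N => // n Nn.
  by rewrite -ball_normE; apply: uN => /=.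
exists (lim (u @ \oo)) => e e0.
have /cvgrPdist_lt/(_ e e0)[N _ uN] := u_cvg.
by exists N => n Nn; rewrite /norm_dist distrC; apply: uN.
Unshelve. all: by end_near.
Qed.

Hypothesis hilbertH : hilbert_space H.

(** Stewart's theorem for the triangle [0], [u], [v] and the point [t *: v]. The value [t = 1/2]
    gives Bruhat-Tits; general [t] gives homogeneity of isometries fixing 0. *)
Lemma hilbert_stewart (u v : H) (t : R) : `|u - t *: v| ^+ 2 =
  (1 - t) * `|u| ^+ 2 + t * `|u - v| ^+ 2 - t * (1 - t) * `|v| ^+ 2.
Proof.
have [dot dotE] := hilbertH; rewrite -!dotE.
have dotC : dot v u = dot u v.
  by rewrite (hermitian_subproof v u) expr0 mul1r.
rewrite !linearBl !linearBr/= !linearZl_LR/= !linearZr_LR/= dotC.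
by rewrite /GRing.scale/=; ring.
Qed.

Lemma hilbert_bruhat_tits : bruhat_tits_inequality R H (@norm_dist R H).
Proof.
move=> p q; exists (p + 2^-1 *: (q - p)) => z; rewrite /norm_dist.
rewrite opprD addrA hilbert_stewart.
have -> : z - p - (q - p) = z - q by rewrite opprB addrA subrK.
rewrite (distrC q p); lra.
Qed.

Lemma linear_part_norm (J : isom (@norm_dist R H)) (v : H) :
  `|linear_part J v| = `|v|.
Proof. by have := isom_dist J v 0; rewrite /norm_dist subr0. Qed.

(* Instead of Mazur-Ulam: [hilbert_stewart] expresses |T(a v) - a T(v)| through
   distances that the isometry T preserves. *)
Lemma linear_partZ (J : isom (@norm_dist R H)) (a : R) (v : H) :
  linear_part J (a *: v) = a *: linear_part J v.
Proof.
have normB u w : `|linear_part J u - linear_part J w| = `|u - w|.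
  rewrite /linear_part opprB addrA subrK; exact: (isom_dist J).
apply/eqP; rewrite -subr_eq0 -normr_eq0 -sqrf_eq0; apply/eqP.
rewrite hilbert_stewart normB !linear_part_norm.
have -> : a *: v - v = (a - 1) *: v by rewrite scalerBl scale1r.
rewrite !normrZ !exprMn !real_normK ?num_real//; ring.
Qed.

Lemma operator_norm_continuous_pointwise (X : topologicalType)
    (J : X -> isom (@norm_dist R H)) :
  operator_norm_continuous J -> forall v, continuous (fun x => J x v : H).
Proof.
move=> [Jlin Jtrans] v x.
have JE y : J y v = linear_part (J y) v + translation_part (J y).
  by rewrite /linear_part subrK.
rewrite /continuous_at JE (funext JE : (fun y => J y v) = _).
apply: cvgD; last exact: Jtrans.
pose D y w := linear_part (J y) w - linear_part (J x) w.
(* Scaling by [|v| + 1] rather than [|v|] brings [v] into the unit ball and covers [v = 0]. *)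
have le_D y : `|D y v| <= operator_norm (D y) * (`|v| + 1).
  have v1 : 0 < `|v| + 1 by rewrite ltr_wpDl.
  have vE : v = (`|v| + 1) *: ((`|v| + 1)^-1 *: v).
    by rewrite scalerA divff ?scale1r// gt_eqF.
  rewrite [in leLHS]vE /D !(linear_partZ _ (`|v| + 1)) -scalerBr normrZ gtr0_norm// mulrC.
  rewrite ler_pM2r//; apply: ub_le_sup.
    (* Linear parts preserve the norm, so 2 bounds the set and [sup] is a true supremum. *)
    exists 2 => _ [w w1 <-]; apply: le_trans (ler_normB _ _) _.
    by rewrite !linear_part_norm -[2]/(1 + 1) lerD.
  exists ((`|v| + 1)^-1 *: v) => //=.
  rewrite normrZ gtr0_norm ?invr_gt0// mulrC ler_pdivrMr// mul1r.
  by rewrite lerDl.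
apply/cvgrPdist_lt => e e0.
have v1 : 0 < `|v| + 1 by rewrite ltr_wpDl.
have /cvgr0_norm_lt/(_ (e / (`|v| + 1))) := Jlin x.
rewrite divr_gt0// => /(_ isT); apply: filterS => y lt_e.
rewrite distrC; apply: le_lt_trans (le_D y) _.
by rewrite -ltr_pdivlMr//; apply: le_lt_trans (ler_norm _) lt_e.
Qed.
End HilbertSpace.

(** * Both kinds of fibre as instances of the abstract theorem *)

Theorem mainTheorem1 (R : realType) (X : metricType R) (Gamma : semigroupType)
    (act : Gamma -> X -> X) :
  compact [set: X] ->
  continuous_semigroup_action act ->
  minimal_action act ->
  (forall (H : metricType R) (I : Gamma -> X -> isom (@mdist R H)),
     proper_space H -> cat0_space H ->
     (forall f, compact_open_continuous (I f)) ->
     isom_cocycle act I ->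
     (exists (x0 : X) (v0 : H) (B : set H),
        metric_bounded B /\ forall f, B (I f x0 v0)) ->
     exists phi : X -> H,
       continuous phi /\ forall f x, I f x (phi x) = phi (act f x)) /\
  (forall (H : completeNormedModType R)
          (I : Gamma -> X -> isom (@norm_dist R H)),
     hilbert_space H -> separable_space H ->
     (forall f, operator_norm_continuous (I f)) ->
     isom_cocycle act I ->
     (exists (x0 : X) (v0 : H) (B : set H),
        bounded_set B /\ forall f, B (I f x0 v0)) ->
     exists phi : X -> H,
       continuous phi /\ forall f x, I f x (phi x) = phi (act f x)).
Proof.
move=> _ act_cont act_min; split=> H I.
  move=> properH catH I_cont I_cocycle bounded_orbit.
  have [|||||||||||phi [phi_cont phi_inv]] :=
      @bounded_orbit_invariant_graph R H (@mdist R H) X Gamma act I.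
  - exact: mdist_ge0.
  - exact: metric_sym.
  - by move=> w u v; apply: metric_triangle.
  - exact: mdist_positivity.
  - exact: proper_sequentially_complete.
  - exact: cat0_bruhat_tits.
  - exact: act_cont.
  - exact: act_min.
  - exact: I_cocycle.
  - move=> f v x e e0.
    have Ifv := compact_open_continuous_pointwise _ _ _ _ (I_cont f) v x.
    have lt_e := metricType_numDomainType.cvgr_dist_lt Ifv e0.
    by near=> y; rewrite metric_sym; near: y; exact: lt_e.
  - exact: bounded_orbit.
  exists phi; split=> // x; apply/metricType_numDomainType.cvgrPdist_lt; exact: phi_cont.
move=> hilbertH _ I_cont I_cocycle [x0 [v0 [B [[r [_ Br]] BI]]]].
have [|||||||||||phi [phi_cont phi_inv]] :=
    @bounded_orbit_invariant_graph R H (@norm_dist R H) X Gamma act I.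
- by move=> u v; apply: normr_ge0.
- by move=> u v; apply: distrC.
- by move=> w u v; apply: ler_distD.
- by move=> u v /normr0_eq0/subr0_eq.
- exact: norm_sequentially_complete.
- exact: hilbert_bruhat_tits.
- exact: act_cont.
- exact: act_min.
- exact: I_cocycle.
- move=> f v x e e0.
  have Ifv := operator_norm_continuous_pointwise _ _ hilbertH _ _ (I_cont f) v x.
  move/cvgrPdist_lt: Ifv => /(_ e e0) lt_e.
  by near=> y; rewrite /norm_dist distrC; near: y; exact: lt_e.
(* [bounded_set] bounds norms only by numbers strictly above [r], such as [r + 1]; twice that bounds
   distances. *)
- exists x0, v0, B; split=> //; exists ((r + 1) + (r + 1)) => u v Bu Bv.
  have r1 : r < r + 1 by rewrite ltrDl.
  by apply: le_trans (ler_normB _ _) _; rewrite lerD// Br.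
exists phi; split=> // x; apply/cvgrPdist_lt; exact: phi_cont.
Unshelve. all: by end_near.
Qed.
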